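(* Let $x,y\in\mathbb{Z}^2$ and let $R_1,R_2$ be nonnegative integers such that $C_d(x,R_1)\cap C_d(y,R_2)\neq\emptyset$. Let $k$ and $n$ denote the numbers of pixels forming the width and the height of the greatest rectangle contained in the intersection set $D_d(x,R_1)\cap D_d(y,R_2)$. Then $$m\bigl(D_d(x,R_1),D_d(y,R_2)\bigr)=2\left(R_1^2+R_2^2+R_1+R_2-2kn+k+n\right).$$
   Context: The digital plane is $\mathbb{Z}^2$; its points are called pixels. The $\mathcal{L}_1$ metric on it is $d(p_1,p_2)=|a_1-a_2|+|b_1-b_2|$ for $p_1=(a_1,b_1)$, $p_2=(a_2,b_2)$. For $x\in\mathbb{Z}^2$ and a nonnegative integer $r$, the digital circle is $C_d(x,r)=\{z\in\mathbb{Z}^2 : d(x,z)=r\}$ and the digital disc is $D_d(x,r)=\{z\in\mathbb{Z}^2 : d(x,z)\le r\}$. For nonempty finite sets $A,B$, the Jaccard-like metric is $m(A,B)=\mathrm{card}(A\bigtriangleup B)=\mathrm{card}(A)+\mathrm{card}(B)-2\,\mathrm{card}(A\cap B)$. A rectangle here means a set of pixels whose sides are parallel to the diagonal directions, i.e. a set of the form $\{p+i(1,1)+j(1,-1) : 0\le i<k,\ 0\le j<n\}$ with $p\in\mathbb{Z}^2$ and integers $k,n\ge 1$; $k$ is the number of pixels of its width and $n$ the number of pixels of its height, so it has $kn$ pixels. The greatest rectangle contained in a set is one with the largest number of pixels among such rectangles contained in the set. *)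

(* Defs.v *)
From HB Require Import structures.
From mathcomp Require Import all_boot all_order all_algebra.
From mathcomp Require Import finmap.
From mathcomp Require Import mathcomp_extra boolp classical_sets functions cardinality.
Set Implicit Arguments.
Unset Strict Implicit.
Unset Printing Implicit Defensive.
Import Order.TTheory GRing.Theory Num.Theory.
Local Open Scope classical_set_scope.
Local Open Scope ring_scope.

Definition dist_L1 (p q : int * int) : int := `|p.1 - q.1| + `|p.2 - q.2|.

Definition digital_circle (x : int * int) (r : nat) : set (int * int) :=
  [set z | dist_L1 x z = r%:Z].

Definition digital_disc (x : int * int) (r : nat) : set (int * int) :=
  [set z | dist_L1 x z <= r%:Z].

(* Number of pixels of a finite set; fset_set sends infinite sets to fset0,
   so the value on them is the junk value 0. *)
Definition npixels (A : set (int * int)) : nat := #|` fset_set A|.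

(* `+` is the symmetric difference of sets. Only meant for finite A and B. *)
Definition jaccard_like (A B : set (int * int)) : nat := npixels (A `+` B).

(* The operations on pixels are those of the product group Z x Z. *)
Definition diag_rectangle (p : int * int) (k n : nat) : set (int * int) :=
  [set z | exists i j : nat, [/\ (i < k)%N, (j < n)%N &
     z = p + (1, 1) *+ i + (1, -1) *+ j]].

Definition greatest_rectangle (A : set (int * int)) (p : int * int)
    (k n : nat) : Prop :=
  [/\ (1 <= k)%N, (1 <= n)%N, diag_rectangle p k n `<=` A &
    forall (q : int * int) (k' n' : nat), (1 <= k')%N -> (1 <= n')%N ->
      diag_rectangle q k' n' `<=` A ->
      (npixels (diag_rectangle q k' n') <= npixels (diag_rectangle p k n))%N].

(* Main.v *)
Require Import Defs.
From HB Require Import structures.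
From mathcomp Require Import all_boot all_order all_algebra.
From mathcomp Require Import finmap.
From mathcomp Require Import mathcomp_extra boolp classical_sets functions cardinality.
From mathcomp Require Import zify.
Set Implicit Arguments.
Unset Strict Implicit.
Import Order.TTheory GRing.Theory Num.Theory.
Local Open Scope classical_set_scope.
Local Open Scope ring_scope.

(** In the coordinates u = z.1 + z.2 and v = z.1 - z.2 the L1 metric becomes the
    maximum metric, so a digital disc is a square in (u, v). Only the pairs with
    u and v of the same parity are pixels; the pixels of a region therefore
    split into two interleaved classes, and a diagonal rectangle, whose steps
    change u or v by 2, stays inside one class.

    Call box a set of pixels cut out by 0 <= u - u0 <= 2a and
    0 <= v - v0 <= 2b, where (u0, v0) is itself a pixel ([diag_box]). The class
    of the corner is a rectangle with (a+1)(b+1) pixels and the other class is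
    a rectangle with ab pixels ([diag_box_rectangles]), so with k = a+1 and
    n = b+1 the box has 2kn - k - n + 1 pixels. A rectangle inside the box has
    sides at most a+1 and b+1, hence the greatest one is k by n
    ([greatest_rectangle_box]).

    A disc of radius R is a box with a = b = R. Two intersecting boxes whose
    corners lie in the same class meet in a box ([diag_boxI]). The circles
    provide the agreement of classes: along the circle around x of radius R1,
    u has the parity of x.1 + x.2 - R1, which is that of the corner of the
    first disc; a common point of the two circles makes the parities of both
    corners equal ([circles_meet_shift]). The formula then follows from
    card(A + B) = card A + card B - 2 card(A & B), with + the symmetric
    difference. *)

Lemma diag_stepE (p : int * int) (i j : nat) :
  p + (1, 1) *+ i + (1, -1) *+ j = (p.1 + i%:Z + j%:Z, p.2 + i%:Z - j%:Z).
Proof.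
have mulrn_pair (c d : int) m : (c, d) *+ m = (c *+ m, d *+ m).
  elim: m => [|m IHm]; first by rewrite !mulr0n.
  by rewrite !mulrS IHm.
rewrite !mulrn_pair; case: p => p1 p2 /=.
by congr (_, _); rewrite ?mulNrn -?natz.
Qed.

(** Listing the pixels makes both the finiteness and the cardinality of a
    rectangle computable. *)
Lemma diag_rectangle_fset (p : int * int) (k n : nat) :
  diag_rectangle p k n =
  [set` [fset z in [seq (p + (1, 1) *+ i + (1, -1) *+ j)%R
                    | i <- iota 0 k, j <- iota 0 n]]%fset].
Proof.
apply/seteqP; split=> z /=; rewrite inE.
  move=> [i [j [ltik ltjn ->]]]; apply/allpairsP.
  by exists (i, j); rewrite !mem_iota !add0n.
move=> /allpairsP[[i j] []]; rewrite !mem_iota !add0n /= => ltik ltjn ->.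
by exists i, j.
Qed.

Lemma finite_diag_rectangle (p : int * int) (k n : nat) :
  finite_set (diag_rectangle p k n).
Proof. by rewrite diag_rectangle_fset; exact: finite_fset. Qed.

Lemma npixels_diag_rectangle (p : int * int) (k n : nat) :
  npixels (diag_rectangle p k n) = (k * n)%N.
Proof.
rewrite /npixels diag_rectangle_fset set_fsetK card_fseq undup_id.
  by rewrite size_allpairs !size_iota.
apply: allpairs_uniq; rewrite ?iota_uniq// => -[i j] [i' j'] _ _ /=.
rewrite !diag_stepE => -[e1 e2]; congr (_, _); lia.
Qed.

Lemma npixelsU (A B : set (int * int)) :
  finite_set A -> finite_set B -> A `&` B = set0 ->
  npixels (A `|` B) = (npixels A + npixels B)%N.
Proof.
move=> finA finB AB0.
by rewrite /npixels fset_setU// cardfsU -fset_setI// AB0 fset_set0 cardfs0 subn0.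
Qed.

Lemma jaccard_like_setI (A B : set (int * int)) :
  finite_set A -> finite_set B ->
  (jaccard_like A B + 2 * npixels (A `&` B) = npixels A + npixels B)%N.
Proof.
move=> finA finB.
have split_size (C D : set (int * int)) : finite_set C ->
    npixels C = (npixels (C `\` D) + npixels (C `&` D))%N.
  move=> finC; rewrite -{1}(setDUK (@subIsetl _ C D)) setDIr setDv set0U setUC.
  apply: npixelsU; [exact: finite_setD|exact: finite_setIl|].
  by apply/seteqP; split=> z //= [[_ nDz] [_ Dz]].
rewrite /jaccard_like (_ : A `+` B = (A `\` B) `|` (B `\` A)) // npixelsU.
- by rewrite (split_size A B)// (split_size B A)// (setIC B A); lia.
- exact: finite_setD.
- exact: finite_setD.
- by apply/seteqP; split=> z //= [[_ nBz] [Bz _]].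
Qed.

(** The corner [p] is a pixel and the side lengths are even, so that all four
    corners of the box are pixels of the same parity class. *)
Definition diag_box (p : int * int) (a b : nat) : set (int * int) :=
  [set z | 0 <= (z.1 + z.2) - (p.1 + p.2) <= 2 * a%:Z /\
           0 <= (z.1 - z.2) - (p.1 - p.2) <= 2 * b%:Z].

Lemma digital_disc_box (x : int * int) (R : nat) :
  digital_disc x R = diag_box (x.1 - R%:Z, x.2) R R.
Proof.
by apply/seteqP; split=> -[z1 z2]; case: x => x1 x2;
  rewrite /digital_disc /diag_box /dist_L1 /=; lia.
Qed.

(** The pixels of the box with u - u0 even are reached from [p] by diagonal
    steps. Those with u - u0 odd satisfy 1 <= u - u0 <= 2a - 1, and likewise
    for v; they are reached from the pixel [(p.1 + 1, p.2)], where u and v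
    both exceed those of [p] by 1. *)
Lemma diag_box_rectangles (p : int * int) (a b : nat) :
  diag_box p a b =
  diag_rectangle p a.+1 b.+1 `|` diag_rectangle (p.1 + 1, p.2) a b.
Proof.
case: p => p1 p2; apply/seteqP; split=> -[z1 z2]; rewrite /diag_box /=.
  move=> [u_bd v_bd].
  (* [s] and [t] are the halves, rounded down, of the offsets of u and v. *)
  pose s := ((z1 + z2 - (p1 + p2)) %/ 2)%Z; pose t := s - (z2 - p2).
  have [us|us] : z1 + z2 - (p1 + p2) = 2 * s \/
                 z1 + z2 - (p1 + p2) = 2 * s + 1 by rewrite /s; lia.
  - left; exists `|s|%N, `|t|%N; rewrite diag_stepE /=.
    by split; [lia|lia|congr (_, _); lia].
  - right; exists `|s|%N, `|t|%N; rewrite diag_stepE /=.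
    by split; [lia|lia|congr (_, _); lia].
by move=> [] [i [j [ltia ltjb]]]; rewrite diag_stepE /= => -[-> ->]; lia.
Qed.

Lemma finite_diag_box (p : int * int) (a b : nat) : finite_set (diag_box p a b).
Proof.
by rewrite diag_box_rectangles finite_setU; split; exact: finite_diag_rectangle.
Qed.

Lemma npixels_diag_box (p : int * int) (a b : nat) :
  npixels (diag_box p a b) = (a.+1 * b.+1 + a * b)%N.
Proof.
rewrite diag_box_rectangles npixelsU ?npixels_diag_rectangle//;
  try exact: finite_diag_rectangle.
(* The two rectangles differ by the parity of u. *)
apply/seteqP; split=> z //= -[[i [j [_ _ ->]]] [i' [j' [_ _]]]].
by rewrite !diag_stepE /= => -[e1 e2]; lia.
Qed.

(** Intersecting intervals takes the maximum of the lower ends and the minimum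
    of the upper ends. The corner [q] is reached from [p] by diagonal steps, so
    the u-ends of both boxes agree modulo 2, and so do the v-ends: the
    resulting intervals again have even length and start at a pixel. *)
Lemma diag_boxI (p : int * int) (s t : int) (a b c d : nat) :
  let q := (p.1 + s + t, p.2 + s - t) in
  diag_box p a b `&` diag_box q c d !=set0 ->
  exists r e f, diag_box p a b `&` diag_box q c d = diag_box r e f.
Proof.
case: p => p1 p2 /= [[w1 w2] []]; rewrite /diag_box /= => pw qw.
(* With u and v measured from [p] and halved, the boxes are
   [0, a] x [0, b] and [s, s + c] x [t, t + d]. *)
pose u0 : int := Num.max 0 s; pose v0 : int := Num.max 0 t.
pose e : int := Num.min a%:Z (s + c%:Z) - u0.
pose f : int := Num.min b%:Z (t + d%:Z) - v0.
exists (p1 + u0 + v0, p2 + u0 - v0), `|e|%N, `|f|%N.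
by apply/seteqP; split=> -[z1 z2] /=; rewrite /e /f /u0 /v0; lia.
Qed.

(** Opposite corners of a k by n rectangle differ by 2(k-1) in u and by 2(n-1)
    in v, whichever parity class the rectangle lies in. *)
Lemma diag_rectangle_sub_box (p q : int * int) (a b k n : nat) :
  (1 <= k)%N -> (1 <= n)%N -> diag_rectangle p k n `<=` diag_box q a b ->
  (k <= a.+1)%N /\ (n <= b.+1)%N.
Proof.
move=> k1 n1 sub.
have corner i j : (i < k)%N -> (j < n)%N ->
    diag_box q a b (p.1 + i%:Z + j%:Z, p.2 + i%:Z - j%:Z).
  by move=> ltik ltjn; apply: sub; exists i, j; rewrite diag_stepE.
have := corner 0%N 0%N k1 n1.
have : diag_box q a b (p.1 + k.-1%:Z + n.-1%:Z, p.2 + k.-1%:Z - n.-1%:Z).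
  by apply: corner; lia.
by rewrite /diag_box /=; lia.
Qed.

(** The parity class of [q] is a rectangle with the extreme sides a+1 and b+1;
    another rectangle with as many pixels must have these same sides. *)
Lemma greatest_rectangle_box (p q : int * int) (a b k n : nat) :
  greatest_rectangle (diag_box q a b) p k n -> k = a.+1 /\ n = b.+1.
Proof.
move=> [k1 n1 sub max_kn].
have [lek len] := diag_rectangle_sub_box k1 n1 sub.
have := max_kn q a.+1 b.+1 isT isT.
rewrite diag_box_rectangles !npixels_diag_rectangle => /(_ (@subsetUl _ _ _)).
by split; nia.
Qed.

(** The left corner of each disc has the parity of any point of its circle,
    because the L1 distance has the parity of the change in u. A common point
    of the circles thus puts both corners in one parity class, whose pixels
    differ by combinations of the two diagonal directions. *)
Lemma circles_meet_shift (x y : int * int) (R1 R2 : nat) :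
  digital_circle x R1 `&` digital_circle y R2 !=set0 ->
  exists s t : int,
    (y.1 - R2%:Z, y.2) = (x.1 - R1%:Z + s + t, x.2 + s - t).
Proof.
move=> [[w1 w2]] []; case: x y => x1 x2 [y1 y2].
rewrite /digital_circle /dist_L1 /= => xw yw.
have [s us] : exists s, y1 - R2%:Z + y2 = x1 - R1%:Z + x2 + 2 * s.
  exists ((y1 - R2%:Z + y2 - (x1 - R1%:Z + x2)) %/ 2)%Z; lia.
by exists s, (s - (y2 - x2)); congr (_, _); lia.
Qed.

Theorem theorem1 (x y : int * int) (R1 R2 : nat)
  (hcircles : digital_circle x R1 `&` digital_circle y R2 !=set0)
  (p : int * int) (k n : nat)
  (hgreatest :
     greatest_rectangle (digital_disc x R1 `&` digital_disc y R2) p k n) :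
  (jaccard_like (digital_disc x R1) (digital_disc y R2))%:Z =
  2 * (R1%:Z ^+ 2 + R2%:Z ^+ 2 + R1%:Z + R2%:Z
       - 2 * k%:Z * n%:Z + k%:Z + n%:Z).
Proof.
have [s [t shift]] := circles_meet_shift hcircles.
have discs_meet : digital_disc x R1 `&` digital_disc y R2 !=set0.
  by case: hcircles => w [xw yw]; exists w; split;
    rewrite /digital_disc /= ?xw ?yw.
move: hgreatest discs_meet; rewrite !digital_disc_box shift => hgreatest meet.
have [r [e [f interE]]] := diag_boxI meet.
move: hgreatest; rewrite interE => /greatest_rectangle_box [-> ->].
have := jaccard_like_setI (finite_diag_box (x.1 - R1%:Z, x.2) R1 R1)
  (finite_diag_box (x.1 - R1%:Z + s + t, x.2 + s - t) R2 R2).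
rewrite interE !npixels_diag_box; nia.
Qed.
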